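(* Let $m\leq n$, $A\in\mathbb{R}^{m\times n}$, $B\in\mathbb{R}^{n\times m}$, and $C\in\mathbb{R}^{m\times m}$. Assume that there exists a matrix $D\in\mathbb{R}^{n\times m}$ such that $I_m=AD$, and that for $S:=B^{\mathrm{T}}D\in\mathbb{R}^{m\times m}$, $\Lambda(S)$ is reciprocal free. Then the T-congruence Sylvester equation $$AX+X^{\mathrm{T}}B=C$$ in the unknown $X\in\mathbb{R}^{n\times m}$ is equivalent to the generalized Sylvester equation $$A\tilde{X}-B^{\mathrm{T}}\tilde{X}S^{\mathrm{T}}=C,$$ where $\tilde{X}\in\mathbb{R}^{n\times m}$ satisfies $X=\tilde{X}-D\tilde{X}^{\mathrm{T}}B$; i.e., the map $\tilde{X}\mapsto X=\tilde{X}-D\tilde{X}^{\mathrm{T}}B$ is a one-to-one correspondence from the set of solutions $\tilde{X}\in\mathbb{R}^{n\times m}$ of the generalized Sylvester equation onto the set of solutions $X\in\mathbb{R}^{n\times m}$ of the T-congruence Sylvester equation.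
   Context: $M^{\mathrm{T}}$ denotes the transpose of $M$ and $I_m$ the $m\times m$ identity matrix. For a square matrix $S\in\mathbb{R}^{m\times m}$, $\Lambda(S)$ denotes its spectrum, i.e., the set of (complex) eigenvalues of $S$. A set $\{\lambda_1,\ldots,\lambda_k\}\subset\mathbb{C}\cup\{\infty\}$ is said to be reciprocal free if $\lambda_i\neq \frac{1}{\lambda_j}$ for any $1\leq i,j\leq k$ (the case $i=j$ is included; the values $0$ and $\infty$ are admitted as elements, with $1/0=\infty$ and $1/\infty=0$). In particular, for the spectrum of a matrix $S$, reciprocal free means that $\lambda\mu\neq 1$ for all $\lambda,\mu\in\Lambda(S)$, including $\lambda=\mu$. Equivalence of the two equations is understood through the change of unknown $X=\tilde{X}-D\tilde{X}^{\mathrm{T}}B$. *)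

(* Defs.v *)
From mathcomp Require Import all_boot all_order all_algebra.
From mathcomp Require Import complex.
From mathcomp Require Import boolp classical_sets functions reals.

Set Implicit Arguments.
Unset Strict Implicit.
Unset Printing Implicit Defensive.

Import Order.TTheory GRing.Theory Num.Theory.
Local Open Scope classical_set_scope.
Local Open Scope ring_scope.
Local Open Scope complex_scope.

(* [option R[i]] stands for the extended complex plane, with [None] as the
   point at infinity; inversion exchanges 0 and infinity. *)
Definition ext_inv (R : realType) (z : option R[i]) : option R[i] :=
  match z with
  | Some x => if x == 0 then None else Some x^-1
  | None => Some 0
  end.

Definition reciprocal_free (R : realType) (L : set (option R[i])) : Prop :=
  forall x y, L x -> L y -> x <> ext_inv y.

(* The eigenvalues of a real matrix are taken in R[i]. [eigenvalue] is defined
   with row eigenvectors, which does not affect the set of eigenvalues. *)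
Definition spectrum (R : realType) (m : nat) (S : 'M[R]_m) : set R[i] :=
  [set l | eigenvalue (map_mx (real_complex R) S) l].

(* Main.v *)
Require Import Defs.
From HB Require Import structures.
From mathcomp Require Import all_boot all_order all_algebra.
From mathcomp Require Import complex.
From mathcomp Require Import boolp classical_sets functions reals.

Set Implicit Arguments.
Unset Strict Implicit.
Unset Printing Implicit Defensive.

Import Order.TTheory GRing.Theory Num.Theory.
Local Open Scope classical_set_scope.
Local Open Scope ring_scope.

(** Write f(Y) = Y - D Y^T B.  Since A D = I and D^T B = S^T, expanding gives
    A f(Y) + f(Y)^T B = A Y - B^T Y S^T for every Y.  Hence Y solves the
    generalized Sylvester equation exactly when f(Y) solves the T-congruence
    equation, and it remains to see that f is a bijection of the whole matrix
    space.  As f is a linear endomorphism in finite dimension, injectivity is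
    enough.

    If f(Y) = 0, then Z = B^T Y satisfies Z = S Z^T, hence the Stein equation
    Z = S Z S^T.  When no product of two eigenvalues of S is 1, this forces
    Z = 0 (lemma [stein_eq0]), so that Y = D Y^T B = D Z^T = 0.

    For the Stein equation, split the characteristic polynomial of S over the
    complex numbers; by Cayley-Hamilton, the product of the S - lambda_i
    annihilates Z.  The factors can be cancelled one by one: any solution W of
    W = S W T with S W = lambda W satisfies W (1 - lambda T) = 0, and
    1 - lambda T is invertible because 1 / lambda is not an eigenvalue of T. *)

Lemma unitmx_1_sub_scale (F : fieldType) (n : nat) (T : 'M[F]_n) (a : F) :
  (forall b, eigenvalue T b -> a * b != 1) -> 1%:M - a *: T \in unitmx.
Proof.
move=> Ta; have [->|a0] := eqVneq a 0; first by rewrite scale0r subr0 unitmx1.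
have -> : 1%:M - a *: T = - a *: (T - a^-1%:M).
  by rewrite scalerBr scale_scalar_mx mulNr divff // scaleNr raddfN /= opprK
             addrC.
rewrite unitmxZ ?unitfE ?oppr_eq0 // -row_free_unit -kermx_eq0.
by apply: contraT => /Ta; rewrite divff // eqxx.
Qed.

(** The homogeneous Stein equation has only the zero solution when no
    eigenvalue of one coefficient is the inverse of one of the other. *)
Lemma stein_eq0 (F : closedFieldType) (m n : nat) (S : 'M[F]_m) (T : 'M[F]_n)
    (Z : 'M[F]_(m, n)) :
  (forall a b, eigenvalue S a -> eigenvalue T b -> a * b != 1) ->
  Z = S *m Z *m T -> Z = 0.
Proof.
(* Evaluation of polynomials, [horner_mx], requires a matrix of positive size. *)
case: m S Z => [|m] S Z hST; first by move=> _; apply: flatmx0.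
have [r Er] := closed_field_poly_normal (char_poly S).
rewrite (monicP (char_poly_monic S)) scale1r in Er.
have r_eig a : a \in r -> eigenvalue S a.
  by rewrite eigenvalue_root_char Er root_prod_XsubC.
have : horner_mx S (\prod_(a <- r) ('X - a%:P)) *m Z = 0.
  by rewrite -Er Cayley_Hamilton mul0mx.
elim: r r_eig {Er} Z => [|a r IHr] r_eig Z.
  by rewrite big_nil rmorph1 mul1mx.
rewrite big_cons mulrC rmorphM rmorphB /= horner_mx_X horner_mx_C -mulmxE.
rewrite -[X in X = 0 -> _]mulmxA => annZ ZE.
(* (S - a) Z is again a solution, annihilated by the remaining factors. *)
have /eqP : (S - a%:M) *m Z = 0.
  apply: (IHr _ _ annZ) => [b br|]; first by apply: r_eig; rewrite inE br orbT.
  rewrite {1}ZE !mulmxA; congr (_ *m _ *m _).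
  by rewrite mulmxBl mulmxBr scalar_mxC.
rewrite mulmxBl mul_scalar_mx subr_eq0 => /eqP SZ.
have aS : eigenvalue S a by apply: r_eig; rewrite mem_head.
have uT : 1%:M - a *: T \in unitmx.
  by apply: unitmx_1_sub_scale => b; apply: hST.
apply: (can_inj (mulmxK uT)); rewrite mul0mx mulmxBr mulmx1 -scalemxAr.
by rewrite scalemxAl -SZ -ZE subrr.
Qed.

Lemma reciprocal_free_spectrum (R : realType) (m : nat) (S : 'M[R]_m) a b :
  reciprocal_free (Some @` spectrum S) ->
  spectrum S a -> spectrum S b -> a * b != 1.
Proof.
move=> rf Sa Sb; apply/eqP => ab1.
have b0 : b != 0 by apply: contra_eq_neq ab1 => ->;
  rewrite mulr0 eq_sym oner_eq0.
apply: (rf (Some a) (Some b)); [by exists a | by exists b|].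
by rewrite /ext_inv (negbTE b0) -[a](mulfK b0) ab1 mul1r.
Qed.

Lemma eigenvalue_tr (F : fieldType) (m : nat) (S : 'M[F]_m) :
  eigenvalue S^T =1 eigenvalue S.
Proof.
by move=> a; rewrite /eigenvalue /eigenspace !kermx_eq0 !row_free_unit
  -unitmx_tr linearB /= trmxK tr_scalar_mx.
Qed.

(** The real case, obtained by embedding the matrices in the complex ones, where
    the spectrum lives. *)
Lemma stein_tr_eq0 (R : realType) (m : nat) (S Z : 'M[R]_m) :
  reciprocal_free (Some @` spectrum S) -> Z = S *m Z *m S^T -> Z = 0.
Proof.
move=> rf ZE; apply/eqP; rewrite -(map_mx_eq0 (real_complex R)); apply/eqP.
apply: (@stein_eq0 _ _ _ (map_mx (real_complex R) S)
                         (map_mx (real_complex R) S)^T) => [a b Sa|].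
  by rewrite eigenvalue_tr; apply: reciprocal_free_spectrum.
by rewrite map_trmx -!map_mxM -ZE.
Qed.

(** An injective linear endomorphism of a finite-dimensional space is onto. *)
Lemma linear_inj_surj (F : fieldType) (V : vectType F) (f : {linear V -> V}) :
  (forall v, f v = 0 -> v = 0) -> forall w, exists v, f v = w.
Proof.
move=> f0 w.
have kf : lker (linfun f) == 0%VS.
  by apply/lker0P => u v /eqP; rewrite !lfunE -subr_eq0 -linearB => /eqP /f0
    /eqP; rewrite subr_eq0 => /eqP.
by exists ((linfun f)^-1%VF w); rewrite -[RHS](lker0_lfunVK kf) lfunE.
Qed.

Section ChangeOfUnknown.
Variables (R : realType) (m n : nat) (B D : 'M[R]_(n, m)).

(** The change of unknown of the T-congruence Sylvester equation. *)
Definition tcongr_subst (Y : 'M[R]_(n, m)) : 'M[R]_(n, m) := Y - D *m Y^T *m B.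

Lemma tcongr_subst_is_linear : linear tcongr_subst.
Proof.
move=> a X Y; rewrite /tcongr_subst linearP /= mulmxDr mulmxDl.
by rewrite -scalemxAr -scalemxAl scalerBr opprD addrACA.
Qed.

HB.instance Definition _ := GRing.isLinear.Build R 'M[R]_(n, m) 'M[R]_(n, m)
  *:%R tcongr_subst tcongr_subst_is_linear.

Lemma tcongr_subst_eq0 (Y : 'M[R]_(n, m)) :
  reciprocal_free (Some @` spectrum (B^T *m D)) ->
  tcongr_subst Y = 0 -> Y = 0.
Proof.
move=> rf /eqP; rewrite subr_eq0 => /eqP YE.
have ZE : B^T *m Y = B^T *m D *m (B^T *m Y)^T.
  by rewrite trmx_mul trmxK {1}YE !mulmxA.
have Z0 : B^T *m Y = 0.
  apply: stein_tr_eq0 rf _.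
  by rewrite [LHS]ZE [in LHS]ZE [in LHS]trmx_mul trmxK !mulmxA.
by rewrite YE -mulmxA -[Y^T *m B]trmxK trmx_mul trmxK Z0 trmx0 mulmx0.
Qed.

Lemma tcongr_substE (A : 'M[R]_(m, n)) (Y : 'M[R]_(n, m)) : A *m D = 1%:M ->
  A *m tcongr_subst Y + (tcongr_subst Y)^T *m B =
  A *m Y - B^T *m Y *m (B^T *m D)^T.
Proof.
move=> AD; rewrite /tcongr_subst [(_ - _)^T]linearB /= !trmx_mul !trmxK.
by rewrite mulmxBr mulmxBl !mulmxA AD mul1mx addrA subrK.
Qed.

End ChangeOfUnknown.

Theorem theorem8 (R : realType) (m n : nat) (hmn : (m <= n)%N)
    (A : 'M[R]_(m, n)) (B : 'M[R]_(n, m)) (C : 'M[R]_m)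
    (D : 'M[R]_(n, m)) (hAD : 1%:M = A *m D)
    (S : 'M[R]_m) (hS : S = B^T *m D)
    (hrf : reciprocal_free (Some @` spectrum S)) :
  set_bij
    [set Xt : 'M[R]_(n, m) | A *m Xt - B^T *m Xt *m S^T = C]
    [set X : 'M[R]_(n, m) | A *m X + X^T *m B = C]
    (fun Xt : 'M[R]_(n, m) => Xt - D *m Xt^T *m B).
Proof.
rewrite {S}hS in hrf *; have AD := esym hAD.
have f0 Y := @tcongr_subst_eq0 _ _ _ B D Y hrf.
split=> [Y /= <-|X Y _ _ fXY|X /= XE].
- exact: tcongr_substE.
- apply/eqP; rewrite -subr_eq0; apply/eqP/f0.
  by rewrite linearB /= /tcongr_subst fXY subrr.
- have [Y fY] := linear_inj_surj f0 X.
  by exists Y => //=; rewrite -tcongr_substE // fY.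
Qed.
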